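(* Let $g\ge 1$ and $n\ge 1$, and let $G_{g,n}$ be the quotient of $B_{g,n}$ by the relations $\sigma_i^2=1$, $i=g+1,g+2,\dots,g+n-1$. Then $G_{g,n}$ is a semi-direct product $$G_{g,n}=F_g^{\,n}\rtimes S_n$$ of the direct product $F_g^{\,n}$ of $n$ copies of the free group $F_g$ of rank $g$ (the normal factor) and the symmetric group $S_n$.
   Context: The braid group $B_{g,n}$ on $n$ strings in the handlebody of genus $g$ is the group with generators $\tau_1,\dots,\tau_g,\sigma_{g+1},\dots,\sigma_{g+n-1}$ and relations: $\sigma_i\sigma_j=\sigma_j\sigma_i$ for $|i-j|>1$; $\sigma_i\sigma_{i+1}\sigma_i=\sigma_{i+1}\sigma_i\sigma_{i+1}$ for $g+1\le i\le g+n-2$; $\tau_k\sigma_i=\sigma_i\tau_k$ for $1\le k\le g$, $i\ge g+2$; $\tau_k(\sigma_{g+1}\tau_k\sigma_{g+1})=(\sigma_{g+1}\tau_k\sigma_{g+1})\tau_k$ for $1\le k\le g$; $\tau_k(\sigma_{g+1}^{-1}\tau_{k+l}\sigma_{g+1})=(\sigma_{g+1}^{-1}\tau_{k+l}\sigma_{g+1})\tau_k$ for $1\le k\le g-1$, $1\le l\le g-k$. *)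

(* Defs.v *)
From HB Require Import structures.
From mathcomp Require Import all_boot all_fingroup.
From mathcomp Require Import boolp.

(* boolp is used only to view Prop-valued congruences as boolean relations, so
   that generic_quotient applies. *)

Set Implicit Arguments.
Unset Strict Implicit.
Unset Printing Implicit Defensive.

Local Open Scope group_scope.
Local Open Scope quotient_scope.

Section FreeGroup.
Variable X : choiceType.

(* The letter (x, true) stands for x and (x, false) for its formal inverse. *)
Inductive free_eq : seq (X * bool) -> seq (X * bool) -> Prop :=
| free_eq_cancel u v x b : free_eq (u ++ (x, b) :: (x, ~~ b) :: v) (u ++ v)
| free_eq_refl u : free_eq u u
| free_eq_sym u v : free_eq u v -> free_eq v u
| free_eq_trans v u w : free_eq u v -> free_eq v w -> free_eq u w.

Definition free_eqb : rel (seq (X * bool)) := fun u v => `[< free_eq u v >].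

Lemma free_eqb_refl : reflexive free_eqb.
Proof. by move=> u; apply/asboolP/free_eq_refl. Qed.

Lemma free_eqb_sym : symmetric free_eqb.
Proof. by move=> u v; apply/asboolP/asboolP; apply: free_eq_sym. Qed.

Lemma free_eqb_trans : transitive free_eqb.
Proof.
by move=> v u w /asboolP uv /asboolP vw; apply/asboolP/(free_eq_trans uv vw).
Qed.

Canonical free_equiv : equiv_rel (seq (X * bool)) :=
  EquivRel free_eqb free_eqb_refl free_eqb_sym free_eqb_trans.

Definition free_group : Type := {eq_quot free_equiv}.
HB.instance Definition _ := Choice.on free_group.

Definition free_pi (u : seq (X * bool)) : free_group :=
  \pi_({eq_quot free_equiv}) u.

Lemma free_piP u v : free_pi u = free_pi v <-> free_eq u v.
Proof.
rewrite /free_pi; split=> [/eqmodP/asboolP //|uv].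
by apply/eqmodP/asboolP.
Qed.

Lemma free_piK (a : free_group) : free_pi (generic_quotient.repr a) = a.
Proof. exact: reprK. Qed.

Lemma free_eq_cat2 a b u v : free_eq u v -> free_eq (a ++ u ++ b) (a ++ v ++ b).
Proof.
elim=> {u v} [u v x c|u|u v _|v u w _ h1 _ h2].
- by rewrite -!catA !cat_cons 2!(catA a u); apply: free_eq_cancel.
- exact: free_eq_refl.
- exact: free_eq_sym.
- exact: free_eq_trans h1 h2.
Qed.

Lemma free_eq_cat u u' v v' :
  free_eq u u' -> free_eq v v' -> free_eq (u ++ v) (u' ++ v').
Proof.
move=> uu' vv'; apply: (@free_eq_trans (u' ++ v)).
  exact: (free_eq_cat2 [::] v uu').
by have := free_eq_cat2 u' [::] vv'; rewrite !cats0.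
Qed.

Definition inv_word (u : seq (X * bool)) : seq (X * bool) :=
  rev [seq (l.1, ~~ l.2) | l <- u].

Lemma inv_word_cat u v : inv_word (u ++ v) = inv_word v ++ inv_word u.
Proof. by rewrite /inv_word map_cat rev_cat. Qed.

Lemma inv_wordK : involutive inv_word.
Proof.
move=> u; rewrite /inv_word map_rev revK -map_comp.
by rewrite -[RHS]map_id; apply: eq_map => -[x b] /=; rewrite negbK.
Qed.

Lemma free_eq_inv u v : free_eq u v -> free_eq (inv_word u) (inv_word v).
Proof.
elim=> {u v} [u v x b|u|u v _|v u w _ h1 _ h2].
- rewrite !inv_word_cat -[_ :: _ :: v]/([:: (x, b); (x, ~~ b)] ++ v).
  rewrite inv_word_cat -catA.
  have -> : inv_word [:: (x, b); (x, ~~ b)] = [:: (x, b); (x, ~~ b)].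
    by rewrite /inv_word /= negbK.
  exact: free_eq_cancel.
- exact: free_eq_refl.
- exact: free_eq_sym.
- exact: free_eq_trans h1 h2.
Qed.

Lemma free_eq_mulV u : free_eq (u ++ inv_word u) [::].
Proof.
elim/last_ind: u => [|u [x b] IHu]; first exact: free_eq_refl.
rewrite -cats1 inv_word_cat -!catA; apply: free_eq_trans IHu.
exact: free_eq_cancel.
Qed.

Definition free_mul (a b : free_group) : free_group :=
  free_pi (generic_quotient.repr a ++ generic_quotient.repr b).
Definition free_one : free_group := free_pi [::].
Definition free_inv (a : free_group) : free_group :=
  free_pi (inv_word (generic_quotient.repr a)).

Lemma free_mul_pi u v : free_mul (free_pi u) (free_pi v) = free_pi (u ++ v).
Proof. by apply/free_piP/free_eq_cat; apply/free_piP; rewrite free_piK. Qed.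

Lemma free_inv_pi u : free_inv (free_pi u) = free_pi (inv_word u).
Proof. by apply/free_piP/free_eq_inv/free_piP; rewrite free_piK. Qed.

Lemma free_mulA : associative free_mul.
Proof.
move=> a b c; rewrite -[a]free_piK -[b]free_piK -[c]free_piK.
by rewrite !free_mul_pi catA.
Qed.

Lemma free_mul1 : left_id free_one free_mul.
Proof. by move=> a; rewrite -[a]free_piK free_mul_pi. Qed.

Lemma free_mulr1 : right_id free_one free_mul.
Proof. by move=> a; rewrite -[a]free_piK free_mul_pi cats0. Qed.

Lemma free_mulrV : right_inverse free_one free_inv free_mul.
Proof.
move=> a; rewrite -[a]free_piK free_inv_pi free_mul_pi.
exact/free_piP/free_eq_mulV.
Qed.

Lemma free_mulV : left_inverse free_one free_inv free_mul.
Proof.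
move=> a; rewrite -[a]free_piK free_inv_pi free_mul_pi.
apply/free_piP; rewrite -{2}[generic_quotient.repr a]inv_wordK.
exact: free_eq_mulV.
Qed.

HB.instance Definition _ := isGroup.Build free_group
  free_mulA free_mul1 free_mulr1 free_mulV free_mulrV.

Definition free_gen (x : X) : free_group := free_pi [:: (x, true)].

End FreeGroup.

Section QuotientByRelations.
Variables (G : groupType) (R : G -> G -> Prop).

(* The smallest congruence containing R: u ~ v iff u * v^-1 lies in the
   normal closure of {r * s^-1 | R r s}. *)
Inductive quot_eq : G -> G -> Prop :=
| quot_eq_rel a b r s : R r s -> quot_eq (a * r * b) (a * s * b)
| quot_eq_refl u : quot_eq u u
| quot_eq_sym u v : quot_eq u v -> quot_eq v u
| quot_eq_trans v u w : quot_eq u v -> quot_eq v w -> quot_eq u w.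

Definition quot_eqb : rel G := fun u v => `[< quot_eq u v >].

Lemma quot_eqb_refl : reflexive quot_eqb.
Proof. by move=> u; apply/asboolP/quot_eq_refl. Qed.

Lemma quot_eqb_sym : symmetric quot_eqb.
Proof. by move=> u v; apply/asboolP/asboolP; apply: quot_eq_sym. Qed.

Lemma quot_eqb_trans : transitive quot_eqb.
Proof.
by move=> v u w /asboolP uv /asboolP vw; apply/asboolP/(quot_eq_trans uv vw).
Qed.

Canonical quot_equiv : equiv_rel G :=
  EquivRel quot_eqb quot_eqb_refl quot_eqb_sym quot_eqb_trans.

Definition quot_group : Type := {eq_quot quot_equiv}.
HB.instance Definition _ := Choice.on quot_group.

Definition quot_pi (u : G) : quot_group := \pi_({eq_quot quot_equiv}) u.

Lemma quot_piP u v : quot_pi u = quot_pi v <-> quot_eq u v.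
Proof.
rewrite /quot_pi; split=> [/eqmodP/asboolP //|uv].
by apply/eqmodP/asboolP.
Qed.

Lemma quot_piK (a : quot_group) : quot_pi (generic_quotient.repr a) = a.
Proof. exact: reprK. Qed.

Lemma quot_eq_mul2 a b u v : quot_eq u v -> quot_eq (a * u * b) (a * v * b).
Proof.
elim=> {u v} [c d r s Rrs|u|u v _|v u w _ h1 _ h2].
- have E t : a * (c * t * d) * b = (a * c) * t * (d * b) by rewrite !mulgA.
  by rewrite !E; apply: quot_eq_rel.
- exact: quot_eq_refl.
- exact: quot_eq_sym.
- exact: quot_eq_trans h1 h2.
Qed.

Lemma quot_eq_mul u u' v v' :
  quot_eq u u' -> quot_eq v v' -> quot_eq (u * v) (u' * v').
Proof.
move=> uu' vv'; apply: (@quot_eq_trans (u' * v)).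
  by have := quot_eq_mul2 1 v uu'; rewrite !mul1g.
by have := quot_eq_mul2 u' 1 vv'; rewrite !mulg1.
Qed.

Lemma quot_eq_inv u v : quot_eq u v -> quot_eq u^-1 v^-1.
Proof.
move=> uv; apply: quot_eq_sym; have := quot_eq_mul2 u^-1 v^-1 uv.
by rewrite mulVg mul1g -mulgA mulgV mulg1.
Qed.

Definition quot_mul (a b : quot_group) : quot_group :=
  quot_pi (generic_quotient.repr a * generic_quotient.repr b).
Definition quot_one : quot_group := quot_pi 1.
Definition quot_inv (a : quot_group) : quot_group :=
  quot_pi (generic_quotient.repr a)^-1.

Lemma quot_mul_pi u v : quot_mul (quot_pi u) (quot_pi v) = quot_pi (u * v).
Proof. by apply/quot_piP/quot_eq_mul; apply/quot_piP; rewrite quot_piK. Qed.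

Lemma quot_inv_pi u : quot_inv (quot_pi u) = quot_pi u^-1.
Proof. by apply/quot_piP/quot_eq_inv/quot_piP; rewrite quot_piK. Qed.

Lemma quot_mulA : associative quot_mul.
Proof.
move=> a b c; rewrite -[a]quot_piK -[b]quot_piK -[c]quot_piK.
by rewrite !quot_mul_pi mulgA.
Qed.

Lemma quot_mul1 : left_id quot_one quot_mul.
Proof. by move=> a; rewrite -[a]quot_piK quot_mul_pi mul1g. Qed.

Lemma quot_mulr1 : right_id quot_one quot_mul.
Proof. by move=> a; rewrite -[a]quot_piK quot_mul_pi mulg1. Qed.

Lemma quot_mulV : left_inverse quot_one quot_inv quot_mul.
Proof. by move=> a; rewrite -[a]quot_piK quot_inv_pi quot_mul_pi mulVg. Qed.

Lemma quot_mulrV : right_inverse quot_one quot_inv quot_mul.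
Proof. by move=> a; rewrite -[a]quot_piK quot_inv_pi quot_mul_pi mulgV. Qed.

HB.instance Definition _ := isGroup.Build quot_group
  quot_mulA quot_mul1 quot_mulr1 quot_mulV quot_mulrV.

Lemma quot_piM : {morph quot_pi : u v / u * v}.
Proof. by move=> u v; rewrite -quot_mul_pi. Qed.

HB.instance Definition _ := isGroupMorphism.Build G quot_group quot_pi
  (fun u v => etrans (quot_piM u v^-1)
                (congr1 (fun c => quot_pi u * c) (esym (quot_inv_pi v)))).

End QuotientByRelations.

Section HandlebodyBraids.
Variables g n : nat.

(* Indices start at 0: k : 'I_g stands for the generator tau_(k+1) and
   i : 'I_n.-1 for sigma_(g+1+i). There is no sigma when n = 1. *)
Definition handlebody_gen : choiceType := ('I_g + 'I_n.-1)%type.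

Definition ftau (k : 'I_g) : free_group handlebody_gen :=
  free_gen (inl k : handlebody_gen).
Definition fsigma (i : 'I_n.-1) : free_group handlebody_gen :=
  free_gen (inr i : handlebody_gen).

Inductive braid_rel :
  free_group handlebody_gen -> free_group handlebody_gen -> Prop :=
| sigma_sigma_far (i j : 'I_n.-1) : (i.+1 < j)%N || (j.+1 < i)%N ->
    braid_rel (fsigma i * fsigma j) (fsigma j * fsigma i)
| sigma_sigma_adjacent (i j : 'I_n.-1) : j = i.+1 :> nat ->
    braid_rel (fsigma i * fsigma j * fsigma i) (fsigma j * fsigma i * fsigma j)
| tau_sigma_far (k : 'I_g) (i : 'I_n.-1) : (0 < i)%N ->
    braid_rel (ftau k * fsigma i) (fsigma i * ftau k)
| tau_sigma_tau (k : 'I_g) (i : 'I_n.-1) : i = 0%N :> nat ->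
    braid_rel (ftau k * (fsigma i * ftau k * fsigma i))
              ((fsigma i * ftau k * fsigma i) * ftau k)
| tau_sigma_tau_lt (k k' : 'I_g) (i : 'I_n.-1) : i = 0%N :> nat -> (k < k')%N ->
    braid_rel (ftau k * ((fsigma i)^-1 * ftau k' * fsigma i))
              (((fsigma i)^-1 * ftau k' * fsigma i) * ftau k).

Definition handlebody_braid_group : groupType := quot_group braid_rel.

Definition sigma (i : 'I_n.-1) : handlebody_braid_group :=
  quot_pi braid_rel (fsigma i).

Inductive sigma_sq_rel :
  handlebody_braid_group -> handlebody_braid_group -> Prop :=
| sigma_sq (i : 'I_n.-1) : sigma_sq_rel (sigma i ^+ 2) 1.

Definition handlebody_braid_quotient : groupType := quot_group sigma_sq_rel.

End HandlebodyBraids.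

(* G is an (internal) semidirect product of a normal subgroup isomorphic to N,
   the image of i, and a complement isomorphic to H, the image of j. *)
Definition is_semidirect_product (G N H : groupType) : Prop :=
  exists (i : {multiplicative N -> G}) (j : {multiplicative H -> G}),
    [/\ injective i, injective j,
        forall (x : G) (a : N), exists b : N, i a ^ x = i b,
        forall (a : N) (b : H), i a = j b -> i a = 1
      & forall x : G, exists (a : N) (b : H), x = i a * j b].

(* Main.v *)
(* The universal property gives a morphism Phi from the quotient to the wreath
   product of F_g and S_n: tau_k goes to the free generator x_k in the first
   coordinate, and sigma_(g+i) to the transposition (i i+1).  For bijectivity,
   write c_p for the ascending product of the first p sigmas.  Since every
   product of sigmas is a product of later sigmas times some c_p, conjugating a
   word in the tau_k by any product of sigmas gives its conjugate by some c_p.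
   As sigma^2 = 1, the relations with k < k' hold for all pairs, and conjugates
   by distinct c_p commute.  Hence every element has the form
   (prod_p w_p ^ c_p) * y with y a product of sigmas, and Phi maps it to
   ((w_p)_p, perm y).  Finally Phi is faithful on products of sigmas, by
   peeling off one c_p after another. *)
From HB Require Import structures.
Require Import Defs.
From mathcomp Require Import all_boot all_fingroup.

Set Implicit Arguments.
Unset Strict Implicit.
Unset Printing Implicit Defensive.

Local Open Scope group_scope.

(** * Commuting conjugates and relations between transpositions *)

Lemma commute_conj (H : groupType) (x y z : H) :
  commute x (y ^ z) <-> commute (x ^ z^-1) y.
Proof.
suff conj_com (a b c : H) : commute a b -> commute (a ^ c) (b ^ c).
  split=> [/(@conj_com _ _ z^-1)|/(@conj_com _ _ z)]; first by rewrite conjgK.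
  by rewrite conjgKV.
by rewrite /commute -!conjMg => ->.
Qed.

Lemma tperm_far (I : finType) (a b c d : I) :
  a != c -> a != d -> b != c -> b != d ->
  commute (tperm a b) (tperm c d).
Proof.
move=> ac ad bc bd; apply/commgP/conjg_fixP.
by rewrite tpermJ !tpermD // eq_sym.
Qed.

(** Since transpositions are involutions, both sides are conjugates of one transposition by another,
    and both equal [tperm a c]. *)
Lemma tperm_braid (I : finType) (a b c : I) : a != b -> a != c -> b != c ->
  tperm a b * tperm b c * tperm a b = tperm b c * tperm a b * tperm b c.
Proof.
move=> ab ac bc.
have := tpermJ b c (tperm a b); rewrite conjgE tpermV mulgA => ->.
have := tpermJ a b (tperm b c); rewrite conjgE tpermV mulgA => ->.
by rewrite tpermR tpermL tpermD // tpermD // eq_sym.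
Qed.

(** * Universal properties of free groups and of quotients by relations *)

Section UniversalProperties.

Section Free.
Variables (X : choiceType) (H : groupType) (f : X -> H).

Let letter (l : X * bool) : H := if l.2 then f l.1 else (f l.1)^-1.

Definition free_lift (a : free_group X) : H :=
  \prod_(l <- generic_quotient.repr a) letter l.

(** The choice of representative does not matter, because a cancelling pair of letters contributes a
    trivial factor. *)
Lemma free_lift_pi u : free_lift (free_pi u) = \prod_(l <- u) letter l.
Proof.
have lift_eq v w : free_eq v w ->
    \prod_(l <- v) letter l = \prod_(l <- w) letter l.
  elim=> {v w} [v w x b|//|//|v w z _ -> _ ->//].
  rewrite !big_cat /= !big_cons; congr (_ * _).
  by case: b; rewrite /letter /= !mulgA ?mulgV ?mulVg ?mul1g.
by apply/lift_eq/free_piP; rewrite free_piK.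
Qed.

Lemma free_liftM : {morph free_lift : a b / a * b}.
Proof.
move=> a b; rewrite -[a]free_piK -[b]free_piK.
by rewrite [_ * _]free_mul_pi !free_lift_pi big_cat.
Qed.

Lemma free_lift1 : free_lift 1 = 1.
Proof. by rewrite free_lift_pi big_nil. Qed.

HB.instance Definition _ := isUMagmaMorphism.Build (free_group X) H free_lift
  (free_lift1, free_liftM).

Lemma free_lift_gen x : free_lift (free_gen x) = f x.
Proof. by rewrite free_lift_pi big_seq1. Qed.

End Free.

Lemma free_group_ind (X : choiceType) (P : free_group X -> Prop) :
  P 1 -> (forall a x, P a -> P (a * free_gen x)) ->
  (forall a x, P a -> P (a * (free_gen x)^-1)) -> forall a, P a.
Proof.
move=> P1 PM PV a; rewrite -[a]free_piK.
elim/last_ind: (generic_quotient.repr a) => [//|u [x b] IHu].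
rewrite -cats1 -free_mul_pi; case: b; first exact: PM.
suff -> : free_pi [:: (x, false)] = (free_gen x)^-1 by apply: PV.
by rewrite /free_gen [RHS]free_inv_pi.
Qed.

Lemma commute_free_lift (X : choiceType) (H : groupType) (f : X -> H) z :
  (forall k, commute z (f k)) -> forall a, commute z (free_lift f a).
Proof.
move=> zf; elim/free_group_ind => [|a x za|a x za].
  by rewrite gmulf1; apply: commute1.
  by rewrite gmulfM /= free_lift_gen; apply: commuteM.
by rewrite gmulfM gmulfV /= free_lift_gen; apply/commuteM/commuteV.
Qed.

Variables (G H : groupType) (R : G -> G -> Prop) (f : UMagmaMorphism.type G H).
Hypothesis fR : forall r s, R r s -> f r = f s.

(* The hypothesis is an explicit argument so that [quot_lift] determines it and
   the morphism instance below can be inferred. *)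
Definition quot_lift of (forall r s, R r s -> f r = f s) :=
  fun a : quot_group R => f (generic_quotient.repr a).

Lemma quot_lift_pi u : quot_lift fR (quot_pi R u) = f u.
Proof.
have lift_eq v w : quot_eq R v w -> f v = f w.
  elim=> {v w} [a b r s /fR frs|//|//|v w z _ -> _ ->//].
  by rewrite !gmulfM frs.
by apply/lift_eq/quot_piP; rewrite quot_piK.
Qed.

Lemma quot_liftM : {morph quot_lift fR : a b / a * b}.
Proof.
move=> a b; rewrite -[a]quot_piK -[b]quot_piK.
by rewrite [_ * _]quot_mul_pi !quot_lift_pi gmulfM.
Qed.

Lemma quot_lift1 : quot_lift fR 1 = 1.
Proof. by rewrite quot_lift_pi gmulf1. Qed.

HB.instance Definition _ := isUMagmaMorphism.Build (quot_group R) H (quot_lift fR)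
  (quot_lift1, quot_liftM).

End UniversalProperties.

Arguments quot_lift : simpl never.

(** * The wreath product of a group with a symmetric group *)

Section WreathProduct.
Variables (F : groupType) (I : finType).

Definition wreath : Type := {ffun I -> F} * {perm I}.
HB.instance Definition _ := Choice.on wreath.

Implicit Types (u v w : wreath).

(** Permutations compose from left to right, so [v.1] is read at the image of [p] under [u.2]. With
    this convention, conjugation by a permutation [s] carries coordinate [p] to coordinate [s p]. *)
Definition wreath_mul u v : wreath :=
  ([ffun p => u.1 p * v.1 (u.2 p)], u.2 * v.2).
Definition wreath_one : wreath := (1, 1).
Definition wreath_inv u : wreath := ([ffun p => (u.1 (u.2^-1 p))^-1], u.2^-1).

Lemma wreath_mulA : associative wreath_mul.
Proof.
move=> u v w; rewrite /wreath_mul /= mulgA; congr (_, _).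
by apply/ffunP => p; rewrite !ffunE permM mulgA.
Qed.

Lemma wreath_mul1 : left_id wreath_one wreath_mul.
Proof.
case=> f s; rewrite /wreath_mul /= mul1g; congr (_, _).
by apply/ffunP => p; rewrite !ffunE perm1 mul1g.
Qed.

Lemma wreath_mulr1 : right_id wreath_one wreath_mul.
Proof.
case=> f s; rewrite /wreath_mul /= mulg1; congr (_, _).
by apply/ffunP => p; rewrite !ffunE mulg1.
Qed.

Lemma wreath_mulV : left_inverse wreath_one wreath_inv wreath_mul.
Proof.
case=> f s; rewrite /wreath_mul /= mulVg; congr (_, _).
by apply/ffunP => p; rewrite !ffunE mulVg.
Qed.

Lemma wreath_mulrV : right_inverse wreath_one wreath_inv wreath_mul.
Proof.
case=> f s; rewrite /wreath_mul /= mulgV; congr (_, _).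
by apply/ffunP => p; rewrite !ffunE permK mulgV.
Qed.

HB.instance Definition _ := isGroup.Build wreath
  wreath_mulA wreath_mul1 wreath_mulr1 wreath_mulV wreath_mulrV.

Lemma wreath_mulE u v :
  u * v = ([ffun p => u.1 p * v.1 (u.2 p)], u.2 * v.2) :> wreath.
Proof. by []. Qed.

Definition wreath_base (f : {ffun I -> F}) : wreath := (f, 1).
Definition wreath_top (s : {perm I}) : wreath := (1, s).

Lemma wreath_baseM : {morph wreath_base : f h / f * h}.
Proof.
move=> f h; rewrite /wreath_base wreath_mulE /= mulg1.
by congr (_, _); apply/ffunP => p; rewrite !ffunE perm1.
Qed.

HB.instance Definition _ := isUMagmaMorphism.Build {ffun I -> F} wreath wreath_base
  (erefl, wreath_baseM).

Lemma wreath_topM : {morph wreath_top : s t / s * t}.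
Proof.
move=> s t; rewrite /wreath_top wreath_mulE /=.
by congr (_, _); apply/ffunP => p; rewrite !ffunE mulg1.
Qed.

HB.instance Definition _ := isUMagmaMorphism.Build {perm I} wreath wreath_top
  (erefl, wreath_topM).

Definition wreath_perm (w : wreath) : {perm I} := w.2.
HB.instance Definition _ := isUMagmaMorphism.Build wreath {perm I} wreath_perm
  (erefl, fun _ _ => erefl).

Lemma wreathE w : w = wreath_base w.1 * wreath_top w.2.
Proof.
case: w => f s; rewrite wreath_mulE /= mul1g.
by congr (_, _); apply/ffunP => p; rewrite !ffunE mulg1.
Qed.

Lemma wreath_baseJ f s :
  wreath_base f ^ wreath_top s = wreath_base [ffun p => f (s^-1 p)].
Proof.
apply: (mulgI (wreath_top s)); rewrite -conjgC /wreath_base /wreath_top.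
rewrite !wreath_mulE /= mulg1 mul1g.
by congr (_, _); apply/ffunP => p; rewrite !ffunE permK mul1g mulg1.
Qed.

Definition single (p : I) (x : F) : {ffun I -> F} :=
  [ffun q => if q == p then x else 1].

Lemma singleM p : {morph single p : x y / x * y}.
Proof.
by move=> x y; apply/ffunP => q; rewrite !ffunE; case: eqP; rewrite ?mulg1.
Qed.

Lemma single1 p : single p 1 = 1.
Proof. by apply/ffunP => q; rewrite !ffunE if_same. Qed.

HB.instance Definition _ p := isUMagmaMorphism.Build F {ffun I -> F} (single p)
  (single1 p, singleM p).

Lemma single_commute p q x y : p != q -> commute (single p x) (single q y).
Proof.
move=> npq; apply/ffunP => r; rewrite !ffunE.
by case: (r =P p) => [->|]; rewrite ?(negPf npq) ?mulg1 ?mul1g.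
Qed.

Lemma prod_single (f : {ffun I -> F}) :
  \prod_(p <- index_enum I) single p (f p) = f.
Proof.
(* The induction runs over duplicate-free lists, so that each coordinate receives at most one
   nontrivial factor. *)
suff prodE r : uniq r -> \prod_(p <- r) single p (f p) =
    [ffun q => if q \in r then f q else 1].
  rewrite prodE ?index_enum_uniq //.
  by apply/ffunP => q; rewrite ffunE mem_index_enum.
elim: r => [_|p r IHr /= /andP[npr ur]].
  by rewrite big_nil; apply/ffunP => q; rewrite !ffunE.
rewrite big_cons IHr //; apply/ffunP => q; rewrite !ffunE inE.
by case: (q =P p) => [->|_]; rewrite ?(negPf npr) ?mulg1 ?mul1g.
Qed.

Lemma single_baseJ p x s :
  wreath_base (single p x) ^ wreath_top s = wreath_base (single (s p) x).
Proof.
rewrite wreath_baseJ; congr wreath_base; apply/ffunP => q.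
by rewrite !ffunE -(inj_eq (@perm_inj _ s)) permKV.
Qed.

(** The base and the top of the wreath product are carried back to [G] along the inverse of
    [Phi]. *)
Lemma wreath_semidirect (G : groupType) (Phi : UMagmaMorphism.type G wreath) :
  bijective Phi -> is_semidirect_product G {ffun I -> F} {perm I}.
Proof.
case=> Psi PhiK PsiK; have PsiM := can2_gmulfM PhiK PsiK.
have Psi1 := can2_gmulf1 PhiK PsiK.
pose psi : UMagmaMorphism.type wreath G :=
  HB.pack Psi (isUMagmaMorphism.Build _ _ Psi (Psi1, PsiM)).
exists (psi \o wreath_base : UMagmaMorphism.type _ _).
exists (psi \o wreath_top : UMagmaMorphism.type _ _).
split=> [a b|a b|x a|a b|x] /=.
- by move/(can_inj PsiK) => [].
- by move/(can_inj PsiK) => [].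
(* Write [Phi x] as base times top: the base part conjugates pointwise, then the top part permutes
   the coordinates. *)
- exists [ffun p => (a ^ (Phi x).1) ((Phi x).2^-1 p)].
  apply: (can_inj PhiK); rewrite PsiK gmulfJ PsiK.
  rewrite {1}[Phi x]wreathE conjgM -gmulfJ.
  exact: wreath_baseJ.
- by move/(can_inj PsiK) => [-> _]; rewrite Psi1.
- exists (Phi x).1, (Phi x).2; apply: (can_inj PhiK).
  by rewrite gmulfM !PsiK -wreathE.
Qed.

End WreathProduct.

(** * Involutions satisfying the Coxeter relations of type A *)

Section CoxeterGenerators.
Variables (G : groupType) (m : nat) (s : nat -> G).
Hypothesis s_sq : forall i, i < m -> s i * s i = 1.
Hypothesis s_far : forall i j, i.+1 < j -> j < m -> commute (s i) (s j).
Hypothesis s_adj : forall i, i.+1 < m ->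
  s i * s i.+1 * s i = s i.+1 * s i * s i.+1.

(** Words in the letters [s i] with [a <= i < m]. As the letters are involutions, these words form a
    standard parabolic subgroup. *)
Inductive parabolic (a : nat) : G -> Prop :=
| parabolic1 : parabolic a 1
| parabolicMs x i : a <= i < m -> parabolic a x -> parabolic a (x * s i).

(** These products, for [a <= k <= m], represent the right cosets of [parabolic a.+1] in
    [parabolic a]; the empty product is the case [k = a]. *)
Definition ascent a k := \prod_(a <= i < k) s i.

Lemma parabolicM a x y : parabolic a x -> parabolic a y -> parabolic a (x * y).
Proof.
move=> px; elim=> [|z i ai _ pxz]; first by rewrite mulg1.
by rewrite mulgA; apply: parabolicMs.
Qed.

Lemma parabolic_gen a i : a <= i < m -> parabolic a (s i).
Proof. by move=> ai; rewrite -[s i]mul1g; apply/parabolicMs/parabolic1. Qed.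

Lemma s_inv i : i < m -> (s i)^-1 = s i.
Proof. by move=> im; apply: mulg1_eq; apply: s_sq. Qed.

Lemma parabolicV a x : parabolic a x -> parabolic a x^-1.
Proof.
elim=> [|y i ai _ pyV]; first by rewrite invg1; apply: parabolic1.
rewrite invgM s_inv ?(andP ai).2 //.
by apply: parabolicM pyV; apply: parabolic_gen.
Qed.

Lemma parabolicS a x : parabolic a.+1 x -> parabolic a x.
Proof.
elim=> [|y i /andP[ai im] _ py]; first exact: parabolic1.
by apply: parabolicMs py; rewrite ltnW.
Qed.

Lemma parabolic_ascent a b k : b <= a -> k <= m -> parabolic b (ascent a k).
Proof.
move=> ba km; rewrite /ascent big_nat; apply: big_ind => [|x y|i /andP[ai ik]].
- exact: parabolic1.
- exact: parabolicM.
- by apply: parabolic_gen; rewrite (leq_trans ba) // (leq_trans ik).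
Qed.

Lemma parabolic_commute a x z : (forall i, a <= i < m -> commute z (s i)) ->
  parabolic a x -> commute z x.
Proof.
move=> zs; elim=> [|y i /zs zsi _ zy]; first exact: commute1.
exact: commuteM.
Qed.

Lemma ascent_far a k i : k < i -> i < m -> commute (s i) (ascent a k).
Proof.
move=> ki im; rewrite /ascent big_nat; apply: commute_prod => j /andP[_ jk].
by apply/commute_sym/s_far => //; apply: leq_ltn_trans ki.
Qed.

Lemma ascentS a k : a <= k -> ascent a k.+1 = ascent a k * s k.
Proof. by move=> ak; rewrite /ascent big_nat_recr. Qed.

(** The letter [s i] passes the factors beyond [s i.+1], the braid relation turns it into [s i.+1]
    in front of [s i * s i.+1], and this letter passes all the earlier factors. *)
Lemma ascent_shift a k i : a <= i -> i.+1 < k -> k <= m ->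
  ascent a k * s i = s i.+1 * ascent a k.
Proof.
move=> ai ik km; have im : i.+1 < m by apply: leq_trans km.
have -> : ascent a k = ascent a i * s i * s i.+1 * ascent i.+2 k.
  rewrite -!ascentS ?leqW // /ascent (big_cat_nat (n := i.+2)) //.
  exact/leqW/leqW.
have sic : commute (s i) (ascent i.+2 k).
  rewrite /ascent big_nat; apply: commute_prod => j /andP[ij jk].
  by apply: s_far => //; apply: leq_trans km.
have sc : commute (s i.+1) (ascent a i) by apply: ascent_far.
by rewrite -!mulgA -sic !mulgA sc -!(mulgA (ascent a i)) -s_adj // !mulgA.
Qed.

(** Append a letter [s i] to [y * ascent a k]. If [i > k], it commutes into [y]; if [i = k], it
    lengthens the ascent; if [i.+1 = k], it cancels the last factor; if [i.+1 < k], it enters [y] as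
    [s i.+1]. *)
Lemma parabolic_coset a x : a <= m -> parabolic a x ->
  exists y k, [/\ parabolic a.+1 y, a <= k <= m & x = y * ascent a k].
Proof.
move=> am; elim=> [|z i /andP[ai im] _ [y [k [py /andP[ak km] ->]]]].
  exists 1, a; rewrite leqnn am /ascent big_geq // mulg1.
  by split=> //; apply: parabolic1.
rewrite -mulgA; case: (ltngtP k i) => [ki|ik|eki].
- exists (y * s i), k; rewrite ak km -mulgA -ascent_far //; split=> //.
  by apply: parabolicMs => //; rewrite im (leq_ltn_trans ak).
- case: (ltngtP i.+1 k) => [ik'|ki|ik'].
  + exists (y * s i.+1), k; rewrite ak km ascent_shift // mulgA; split=> //.
    by apply: parabolicMs => //; rewrite ltnS ai (leq_trans ik').
  + by rewrite ltnNge ik in ki.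
  + exists y, i; rewrite ai ltnW // -ik' ascentS // -mulgA s_sq // mulg1.
    by split.
- by exists y, k.+1; rewrite leqW // eki im ascentS -?eki.
Qed.

Variable pi : UMagmaMorphism.type G {perm 'I_m.+1}.
Hypothesis pi_s : forall i, i < m -> pi (s i) = tperm (inord i) (inord i.+1).

Lemma parabolic_fix a x (p : 'I_m.+1) : parabolic a x -> p < a -> pi x p = p.
Proof.
move=> px pa; elim: px => [|y i /andP[ai im] _ IHy].
  by rewrite gmulf1 perm1.
have pi_lt : p < i by apply: leq_trans ai.
rewrite gmulfM permM IHy pi_s // tpermD // -val_eqE /= inordK ?ltnS //.
- by rewrite gtn_eqF.
- exact: ltnW.
- by rewrite gtn_eqF // ltnW.
Qed.

Lemma ascent_pi a k : a <= k <= m -> pi (ascent a k) (inord a) = inord k.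
Proof.
have pi_nil : pi (ascent a a) (inord a) = inord a.
  by rewrite /ascent big_geq // gmulf1 perm1.
elim: k => [|k IHk]; first by rewrite leqn0 => /andP[/eqP a0 _]; rewrite -a0.
rewrite leq_eqVlt => /andP[/predU1P[<- //|]].
rewrite ltnS => ak km; rewrite ascentS // gmulfM permM IHk ?ak 1?ltnW //.
by rewrite pi_s // tpermL.
Qed.

(** In the coset form [y * ascent a k], the image of [y] fixes [a] and the ascent sends [a] to [k].
    A trivial image therefore forces [k = a], which puts [x] in [parabolic a.+1], and the argument
    repeats. *)
Lemma parabolic_faithful a x : parabolic a x -> pi x = 1 -> x = 1.
Proof.
(* The bound [d] on [m.+1 - a] decreases as [a] grows; once [a > m], no letter is available and [x]
   is the empty word. *)
move: {2}(m.+1 - a) (leqnn (m.+1 - a)) => d.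
elim: d a x => [|d IHd] a x ad px pix.
  case: px => // y i /andP[ai im]; move: ad; rewrite leqn0 subn_eq0 => ma.
  by have := leq_trans ma (leq_trans ai (ltnW im)); rewrite ltnn.
have [am|ma] := leqP a m; last first.
  case: px => // y i /andP[ai im].
  by have := leq_trans ma (leq_trans ai (ltnW im)); rewrite ltnn.
have [y [k [py akm ex]]] := parabolic_coset am px.
have: pi x (inord a) = inord k.
  by rewrite ex gmulfM permM (parabolic_fix py) ?inordK // ascent_pi.
rewrite pix perm1 => /(congr1 val); rewrite /= !inordK ?ltnS ?(andP akm).2 //.
move=> eak; move: ex; rewrite -eak /ascent big_geq // mulg1 => ex.
by subst y; apply: IHd py pix; rewrite subnS -subn1 leq_subLR add1n.
Qed.

(** Dividing [t] by the ascent from [a] to the image of [a] makes [a] a further fixed point, and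
    induction applies. *)
Lemma parabolic_onto a (t : {perm 'I_m.+1}) :
  (forall p : 'I_m.+1, p < a -> t p = p) -> exists2 x, parabolic a x & pi x = t.
Proof.
move: {2}(m.+1 - a) (leqnn (m.+1 - a)) => d.
elim: d a t => [|d IHd] a t ad tfix.
  exists 1; first exact: parabolic1.
  rewrite gmulf1; apply/permP => p; rewrite perm1 tfix //.
  by rewrite (leq_trans (ltn_ord p)) // -subn_eq0 -leqn0.
have [am|ma] := leqP a m; last first.
  exists 1; first exact: parabolic1.
  rewrite gmulf1; apply/permP => p; rewrite perm1 tfix //.
  exact: leq_trans (ltn_ord p) ma.
pose A : 'I_m.+1 := inord a; have vA : val A = a by rewrite /A /= inordK.
have akm : a <= t A <= m.
  (* If [t A] were below [a], then [t] would fix it, and injectivity would give [t A = A]. *)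
  rewrite -(ltnS _ m) ltn_ord andbT leqNgt; apply/negP.
  move=> /[dup] tA /tfix /perm_inj tAA.
  by rewrite tAA vA ltnn in tA.
pose z := ascent a (t A).
have pz : parabolic a z by apply: parabolic_ascent => //; case/andP: akm.
have [] := IHd a.+1 (t * (pi z)^-1).
- by rewrite subnS -subn1 leq_subLR add1n.
- move=> p; rewrite ltnS leq_eqVlt permM => /predU1P[pa|pa].
    have ->: p = A by apply: val_inj; rewrite vA.
    by apply: (canLR (permK _)); rewrite ascent_pi // inord_val.
  by rewrite tfix //; apply: (canLR (permK _)); rewrite (parabolic_fix pz).
- move=> y py eyt; exists (y * z); first exact/parabolicM/pz/parabolicS.
  by rewrite gmulfM eyt mulgVK.
Qed.

End CoxeterGenerators.

(** * Normal form for the group generated by [T] and the involutions *)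

Section NormalForm.
Variables (F G : groupType) (m : nat) (s : nat -> G).
Variables (T : UMagmaMorphism.type F G)
  (Phi : UMagmaMorphism.type G (wreath F 'I_m.+1)).
Hypothesis s_sq : forall i, i < m -> s i * s i = 1.
Hypothesis s_far : forall i j, i.+1 < j -> j < m -> commute (s i) (s j).
Hypothesis s_adj : forall i, i.+1 < m ->
  s i * s i.+1 * s i = s i.+1 * s i * s i.+1.
Hypothesis T_far : forall x i, 0 < i < m -> commute (T x) (s i).
Hypothesis T_s0 : forall x y, 0 < m -> commute (T x) (T y ^ s 0).
Hypothesis generated : forall P : G -> Prop, P 1 ->
  (forall x y, P x -> P (x * T y)) ->
  (forall x i, i < m -> P x -> P (x * s i)) ->
  forall x, P x.
Hypothesis Phi_T : forall x, Phi (T x) = wreath_base (single ord0 x).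
Hypothesis Phi_s : forall i, i < m ->
  Phi (s i) = wreath_top F (tperm (inord i) (inord i.+1)).

Let pi : UMagmaMorphism.type G {perm 'I_m.+1} := @wreath_perm F 'I_m.+1 \o Phi.

Let pi_s i : i < m -> pi (s i) = tperm (inord i) (inord i.+1).
Proof. by move=> im; rewrite /pi /= Phi_s. Qed.

Let asc k := ascent s 0 k.
Let par_asc (p : 'I_m.+1) : parabolic m s 0 (asc p).
Proof. by apply: parabolic_ascent => //; rewrite -ltnS. Qed.

Let pi_asc (p : 'I_m.+1) : pi (asc p) ord0 = p.
Proof.
rewrite -[ord0]inord_val ascent_pi ?inord_val //.
by rewrite /= -ltnS.
Qed.

Lemma Phi_parabolic a y : parabolic m s a y -> Phi y = wreath_top F (pi y).
Proof.
elim=> [|z i /andP[_ im] _ IHz]; first by rewrite !gmulf1.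
by rewrite !gmulfM IHz pi_s // Phi_s.
Qed.

(** The copy of [F] that [Phi] sends to coordinate [p] of the base. *)
Definition strand (p : 'I_m.+1) x := T x ^ ascent s 0 p.

Lemma strandM p : {morph strand p : x y / x * y}.
Proof. by move=> x y; rewrite /strand gmulfM; apply: conjMg. Qed.

Lemma strand1 p : strand p 1 = 1.
Proof. by rewrite /strand gmulf1; apply: conj1g. Qed.

Lemma T_conj_parabolic1 y x : parabolic m s 1 y -> T x ^ y = T x.
Proof.
move=> py; have Txy : commute (T x) y.
  by apply: parabolic_commute py => i; apply: T_far.
by rewrite conjgE Txy mulKg.
Qed.

(** By the coset decomposition, [y] is a product of later letters, which commute with [T x],
    followed by an ascent from [0]. The end of that ascent is the image of [ord0]. *)
Lemma T_conj_parabolic y x : parabolic m s 0 y ->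
  T x ^ y = strand (pi y ord0) x.
Proof.
move=> py; have [z [k [pz /andP[_ km] ->]]] :=
  parabolic_coset s_sq s_far s_adj (leq0n m) py.
have k_asc : k = (inord k : 'I_m.+1) by rewrite inordK.
rewrite conjgM T_conj_parabolic1 // gmulfM permM (parabolic_fix pi_s pz) //.
by rewrite k_asc pi_asc.
Qed.

(** Conjugating by the inverse of [asc p] reduces the claim to strands [ord0] and [r] with [r]
    nonzero, where it is a conjugate of [T_s0]. *)
Lemma strand_commute p q x y : p != q -> commute (strand p x) (strand q y).
Proof.
move=> npq; apply: (conjg_inj (asc p)^-1).
rewrite (conjMg (strand p x)) (conjMg (strand q y)) /strand.
have pqp : parabolic m s 0 (asc q * (asc p)^-1) by apply/parabolicM/parabolicV.
rewrite conjgK -conjgM T_conj_parabolic //; set r := pi _ _.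
have r0 : r != ord0.
  apply: contraNneq npq => r0; apply/eqP.
  rewrite -[RHS]pi_asc -[asc q](mulgVK (asc p)) gmulfM permM.
  by rewrite -/r r0 pi_asc.
have r_gt0 : 0 < r by rewrite lt0n.
have rm : r <= m by rewrite -ltnS.
have per : parabolic m s 1 (ascent s 1 r) by apply: parabolic_ascent.
(* Split the ascent to [r] as [s 0] times [ascent s 1 r]. The second factor fixes [T x], so both
   elements are conjugates by it. *)
rewrite /strand /ascent big_ltn // conjgM -(T_conj_parabolic1 x per).
by rewrite -(conjMg (T x)) -(conjMg _ (T x)) T_s0 // (leq_trans r_gt0).
Qed.

Lemma prod_strand_mul (f : {ffun 'I_m.+1 -> F}) q x :
  exists h : {ffun 'I_m.+1 -> F},
  (\prod_(p <- index_enum 'I_m.+1) strand p (f p)) * strand q x =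
  \prod_(p <- index_enum 'I_m.+1) strand p (h p).
Proof.
(* The new factor moves left past the strands listed after [q] and merges with the factor at [q]. *)
exists (f * single q x); have := mem_index_enum q.
have : uniq (index_enum 'I_m.+1) by apply: index_enum_uniq.
elim: index_enum => // p r IHr /= /andP[npr ur]; rewrite inE !big_cons !ffunE.
case: (eqVneq q p) => [-> _|nqp /= qr]; last first.
  by rewrite mulg1 -mulgA IHr.
rewrite strandM -[LHS]mulgA -[RHS]mulgA; congr (_ * _).
have com : commute (strand p x) (\prod_(j <- r) strand j (f j)).
  rewrite big_seq; apply: commute_prod => j jr; apply: strand_commute.
  by apply: contraNneq npr => ->.
rewrite -com; congr (_ * _); apply: eq_big_seq => j jr; rewrite !ffunE.
by case: eqP npr => [<-|_]; rewrite ?jr ?mulg1.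
Qed.

Lemma normal_form x : exists (f : {ffun 'I_m.+1 -> F}) y,
  parabolic m s 0 y /\ x = \prod_(p <- index_enum 'I_m.+1) strand p (f p) * y.
Proof.
elim/generated: x => [|_ t [f [y [py ->]]]|_ i im [f [y [py ->]]]].
- exists 1, 1; split; first exact: parabolic1.
  by rewrite mulg1 big1 // => p _; rewrite ffunE strand1.
(* Moving [T t] to the left of [y] conjugates it by [y^-1], which puts it on strand
   [pi y^-1 ord0]. *)
- have [h fh] := prod_strand_mul f (pi y^-1 ord0) t.
  exists h, y; split=> //; rewrite -fh -[LHS]mulgA -[RHS]mulgA; congr (_ * _).
  rewrite -T_conj_parabolic; first exact: conjgCV.
  exact: parabolicV.
- exists f, (y * s i); rewrite mulgA; split=> //.
  exact: parabolicMs.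
Qed.

Lemma Phi_normal_form (f : {ffun 'I_m.+1 -> F}) y : parabolic m s 0 y ->
  Phi (\prod_(p <- index_enum 'I_m.+1) strand p (f p) * y) = (f, pi y).
Proof.
move=> py; rewrite gmulfM (Phi_parabolic py) [RHS]wreathE; congr (_ * _).
rewrite -[in RHS](prod_single f) !gmulf_prod; apply: eq_bigr => p _.
by rewrite gmulfJ Phi_T (Phi_parabolic (par_asc p)) single_baseJ pi_asc.
Qed.

(** The image of a normal form displays [f] and [pi y]. A trivial image thus gives [f = 1] and, by
    [parabolic_faithful], [y = 1]; conversely, [parabolic_onto] supplies a [y] for every
    permutation. *)
Lemma wreath_iso : bijective Phi.
Proof.
have injPhi : injective Phi.
  apply: gmulf_inj => x; have [f [y [py ->]]] := normal_form x.
  rewrite Phi_normal_form // => -[f1 y1].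
  rewrite (parabolic_faithful _ _ _ pi_s py) //.
  by rewrite mulg1 big1 // => p _; rewrite f1 ffunE strand1.
have onto w : exists x, Phi x = w.
  have [|y py yw] := parabolic_onto pi_s (a := 0) (t := w.2); first by [].
  exists (\prod_(p <- index_enum 'I_m.+1) strand p (w.1 p) * y).
  by rewrite Phi_normal_form // yw; case: w {yw}.
(* Choosing preimages produces the inverse function that [bijective] requires. *)
have [Psi PhiPsi] := boolp.choice onto.
by exists Psi => // x; apply: injPhi.
Qed.

End NormalForm.

(** * The handlebody braid quotient as an instance of the normal form *)

Section HandlebodyQuotient.
Variables g m : nat.

Let F : groupType := free_group 'I_g.
Let G := handlebody_braid_quotient g m.+1.
Let W : groupType := wreath F 'I_m.+1.

Let proj : UMagmaMorphism.type (free_group (handlebody_gen g m.+1)) G :=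
  quot_pi (@sigma_sq_rel g m.+1) \o quot_pi (@braid_rel g m.+1).

Let tau (k : 'I_g) : G := proj (ftau m.+1 k).
Let sig (i : 'I_m) : G := proj (@fsigma g m.+1 i).

Let proj_rel r s : braid_rel r s -> proj r = proj s.
Proof.
move=> rs; congr quot_pi; apply/quot_piP.
by have := quot_eq_rel 1 1 rs; rewrite !mul1g !mulg1.
Qed.

Let sig_sq i : sig i * sig i = 1.
Proof.
rewrite /sig -gmulfM; apply/quot_piP.
have := quot_eq_rel 1 1 (@sigma_sq g m.+1 i).
by rewrite !mul1g !mulg1 expg2 -gmulfM.
Qed.

Let sig_inv i : (sig i)^-1 = sig i.
Proof. exact/mulg1_eq. Qed.

Let T : UMagmaMorphism.type F G := free_lift tau.

Let T_gen k : T (free_gen k) = tau k.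
Proof. exact: free_lift_gen. Qed.

(** Extended by the default value [1] for [i >= m], so that the generators are indexed by natural
    numbers. *)
Let s (i : nat) : G := if insub i is Some j then sig j else 1.

Let s_ord i (im : i < m) : s i = sig (Ordinal im).
Proof. by rewrite /s insubT. Qed.

Let s_val (i : 'I_m) : s i = sig i.
Proof. by rewrite /s valK. Qed.

Lemma tau_conj_commute k k' (i : 'I_m) : i = 0%N :> nat ->
  commute (tau k) (tau k' ^ sig i).
Proof.
move=> i0; have lt_com (h h' : 'I_g) : h < h' -> commute (tau h) (tau h' ^ sig i).
  move=> hh; have := proj_rel (@tau_sigma_tau_lt g m.+1 h h' i i0 hh).
  by rewrite !gmulfM gmulfV -mulgA.
(* For [k > k'], the relation for the reversed pair is conjugated by [sig i], which is its own
   inverse. For [k = k'], the same fact turns [tau_sigma_tau] into the claim. *)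
case: (ltngtP k k') => [/lt_com //|/lt_com|/val_inj <-].
  by move/commute_conj; rewrite sig_inv => /commute_sym.
have := proj_rel (@tau_sigma_tau g m.+1 k i i0); rewrite !gmulfM -/(sig i) -/(tau k).
by rewrite conjgE sig_inv (mulgA (sig i)).
Qed.

Let gen_image (x : handlebody_gen g m.+1) : W :=
  match x with
  | inl k => wreath_base (single ord0 (free_gen k))
  | inr i => wreath_top F (tperm (inord i) (inord i.+1))
  end.

Let inord_eq i j : i <= m -> j <= m ->
  (inord i == inord j :> 'I_m.+1) = (i == j).
Proof. by move=> im jm; rewrite -val_eqE /= !inordK. Qed.

Lemma gen_image_rel r t : braid_rel r t ->
  free_lift gen_image r = free_lift gen_image t.
Proof.
have far (i j : 'I_m) : i.+1 < j ->
    commute (gen_image (inr i)) (gen_image (inr j)).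
  move=> ij; apply: gmulf_commute; have := ltn_ord j; move: (ltn_ord i) => im jm.
  have [im' jm' ij'] : [/\ i <= m, j <= m & i < j] by split; apply: ltnW.
  have ij'' : i < j.+1 by apply: leqW.
  by apply: tperm_far; rewrite inord_eq // ltn_eqF.
(* The transposition of [0] and [1] moves one factor to coordinate [1], where it commutes with
   coordinate [0]. Both families of relations linking tau and the first sigma follow from this. *)
have tau_conj (k k' : 'I_g) (i : 'I_m) : i = 0%N :> nat ->
    commute (gen_image (inl k)) (gen_image (inl k') ^ gen_image (inr i)).
  move=> i0; rewrite /gen_image i0 single_baseJ; apply/gmulf_commute/single_commute.
  rewrite -[ord0]inord_val tpermL inord_eq //.
  by rewrite (leq_ltn_trans _ (ltn_ord i)).
case=> [i j|i j ji|k i i_gt0|k i i0|k k' i i0 kk'];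
  rewrite !gmulfM ?gmulfV /= !free_lift_gen.
- by case/orP => /far // /commute_sym.
- rewrite -!gmulfM; congr wreath_top; rewrite ji; have := ltn_ord j; rewrite ji => im.
  have im' : i <= m by do 2!apply: ltnW.
  by apply: tperm_braid; rewrite inord_eq ?ltn_eqF // ltnW.
(* For [i > 0], the transposition fixes [0], so it centralises the first coordinate. *)
- rewrite [LHS]conjgC; congr (_ * _); rewrite single_baseJ; congr wreath_base.
  rewrite tpermD // -[ord0]inord_val inord_eq //; last by rewrite ltnW.
  by rewrite -lt0n.
- have := tau_conj k k i i0; rewrite conjgE -gmulfV tpermV.
  by rewrite mulgA.
- by have := tau_conj k k' i i0; rewrite conjgE mulgA.
Qed.

Let Phi0 : UMagmaMorphism.type _ W := quot_lift gen_image_rel.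

Lemma sigma_sq_image r t : sigma_sq_rel r t -> Phi0 r = Phi0 t.
Proof.
case=> i; rewrite expg2 gmulfM gmulf1 /= /sigma !quot_lift_pi /= free_lift_gen.
by rewrite -gmulfM tperm2.
Qed.

Let Phi : UMagmaMorphism.type G W := quot_lift sigma_sq_image.

Let Phi_proj a : Phi (proj a) = free_lift gen_image a.
Proof. by rewrite /= quot_lift_pi /= quot_lift_pi. Qed.

Lemma handlebody_wreath_iso : bijective Phi.
Proof.
apply: (@wreath_iso F G m s T Phi).
- by move=> i im; rewrite (s_ord im).
- move=> i j ij jm; have im : i < m by apply: ltn_trans jm; apply: ltnW.
  rewrite (s_ord im) (s_ord jm) /commute -!gmulfM.
  by apply/proj_rel/sigma_sigma_far; rewrite ij.
- move=> i im; rewrite (s_ord (ltnW im)) (s_ord im).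
  have := proj_rel (@sigma_sigma_adjacent g m.+1
    (Ordinal (ltnW im)) (Ordinal im) erefl).
  by rewrite !gmulfM.
- move=> x i /andP[i0 im]; apply/commute_sym/commute_free_lift => k.
  apply: commute_sym; rewrite (s_ord im) /commute -!gmulfM.
  exact/proj_rel/tau_sigma_far.
- move=> x y m0; rewrite (s_ord m0).
  (* [commute_conj] shifts the conjugation onto the other factor, so that each lift in turn is
     reduced to generators. *)
  apply/commute_conj/commute_free_lift => k; apply/commute_conj.
  apply/commute_sym/commute_free_lift => k'; apply: commute_sym.
  exact: tau_conj_commute.
- move=> P P1 PT Ps x; rewrite -[x]quot_piK -[generic_quotient.repr x]quot_piK.
  rewrite -[quot_pi _ _]/(proj _); elim/free_group_ind: (generic_quotient.repr _).
  + by rewrite gmulf1.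
  + move=> a [k|i] Pa; rewrite gmulfM.
      by have := PT _ (free_gen k) Pa; rewrite T_gen.
    by have := Ps _ i (ltn_ord i) Pa; rewrite s_val.
  + move=> a [k|i] Pa; rewrite gmulfM gmulfV.
      by have := PT _ (free_gen k)^-1 Pa; rewrite gmulfV T_gen.
    (* An inverse sigma letter is handled as the letter itself. *)
    rewrite -[proj (free_gen _)]/(sig i) sig_inv.
    by have := Ps _ i (ltn_ord i) Pa; rewrite s_val.
- move=> x; elim/free_group_ind: x => [|a k IHa|a k IHa].
  + by rewrite !gmulf1.
  + by rewrite !gmulfM IHa T_gen Phi_proj free_lift_gen.
  + by rewrite !gmulfM IHa !gmulfV T_gen Phi_proj free_lift_gen.
- by move=> i im; rewrite (s_ord im) Phi_proj free_lift_gen.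
Qed.

End HandlebodyQuotient.

Theorem theorem3 (g n : nat) (hg : 1 <= g) (hn : 1 <= n) :
  is_semidirect_product
    (handlebody_braid_quotient g n)
    {ffun 'I_n -> free_group 'I_g}
    'S_n.
Proof.
(* Writing [n = m.+1] makes the sigmas indexed by ['I_m] and the strands by ['I_m.+1]. *)
case: n hn => // m _; exact: wreath_semidirect (handlebody_wreath_iso g m).
Qed.
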